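(* Let $I$ be a set and suppose $1 \leq p \leq\infty$, $p\neq2$. Then every isometric Schur multiplier on $S_p^I$ is defined by a matrix of the form $[a_ib_j]_{i,j\in I}$ with $a_i,b_j \in \mathbb{T}$.
   Context: $\mathbb{T}=\{z\in\mathbb{C}: |z|=1\}$. For $1\le p<\infty$, $S_p^I$ is the Schatten class of compact operators $A$ on $\ell_2^I$ with $\|A\|_{S_p^I}=(\mathrm{Tr}\,(A^*A)^{p/2})^{1/p}<\infty$; $S_\infty^I$ is the space of compact operators on $\ell_2^I$ with the operator norm. Elements are regarded as $I\times I$ matrices. $*$ is the Schur (entrywise) product $[a_{ij}]*[b_{ij}]=[a_{ij}b_{ij}]$. A matrix $A$ defines a Schur multiplier $M_A$ on $S_p^I$ if $M_A(B)=A*B\in S_p^I$ for all $B\in S_p^I$; it is isometric if $\|M_A(B)\|_{S_p^I}=\|B\|_{S_p^I}$ for all $B\in S_p^I$. *)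

(* Defs.v *)
From HB Require Import structures.
From mathcomp Require Import all_boot all_order all_algebra.
From mathcomp Require Import all_classical all_reals all_analysis.
From mathcomp Require Import complex.
From mathcomp Require summability.
From mathcomp Require Import ring lra.

Set Implicit Arguments.
Unset Strict Implicit.
Unset Printing Implicit Defensive.

Import Order.TTheory GRing.Theory Num.Theory.
Import numFieldNormedType.Exports.

Local Open Scope classical_set_scope.
Local Open Scope ring_scope.
Local Open Scope complex_scope.

Section ell2_space.
Context {R : realType} {I : choiceType}.

Definition sqsum (x : I -> R[i]^o) : \bar R :=
  \esum_(i in [set: I]) ((complex.Re `|x i|) ^+ 2)%:E.

Definition square_summable : {pred I -> R[i]^o} :=
  [pred x | `[< (sqsum x < +oo)%E >]].

Let Re_norm_ge0 (z : R[i]^o) : (0 <= complex.Re `|z|)%R.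
Proof. by have := normr_ge0 z; rewrite lecE => /andP[]. Qed.

Let Re_normE (z : R[i]^o) : (complex.Re `|z|)%:C%C = `|z|%R.
Proof. by rewrite RRe_real// normr_real. Qed.

Let Re_normD (z w : R[i]^o) :
  (complex.Re `|z + w| <= complex.Re `|z| + complex.Re `|w|)%R.
Proof. by rewrite -lecR rmorphD/= !Re_normE ler_normD. Qed.

Let Re_normM (z w : R[i]^o) :
  (complex.Re `|z * w| = complex.Re `|z| * complex.Re `|w|)%R.
Proof.
by apply: (fmorph_inj (real_complex R)); rewrite rmorphM/= !Re_normE normrM.
Qed.

Let esumZ_le (f : I -> R) (c : R) : (0 <= c)%R -> (forall i, 0 <= f i)%R ->
  (\esum_(i in [set: I]) (c * f i)%:E <=
     c%:E * \esum_(i in [set: I]) (f i)%:E)%E.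
Proof.
move=> c0 f0; apply: ge_ereal_sup => _ [A [finA _] <-].
under eq_fsbigr do rewrite EFinM.
rewrite -ge0_mule_fsumr; last by move=> i; rewrite lee_fin.
apply: lee_wpmul2l; first by rewrite lee_fin.
by apply: esum_ge; exists A.
Qed.

Lemma sqsum_ge0 x : (0 <= sqsum x)%E.
Proof. by apply: esum_ge0 => i _; rewrite lee_fin sqr_ge0. Qed.

Lemma sqsumD_le (x y : I -> R[i]^o) (t : R) : (0 < t)%R ->
  (sqsum (x + y)%R <= (1 + t)%:E * sqsum x + (1 + t^-1)%:E * sqsum y)%E.
Proof.
move=> t0; have ti0 : (0 < t^-1)%R by rewrite invr_gt0.
apply: (@le_trans _ _ (\esum_(i in [set: I])
   (((1 + t) * complex.Re `|x i| ^+ 2)%:E +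
    ((1 + t^-1) * complex.Re `|y i| ^+ 2)%:E)%E)).
  apply: le_esum => i _; rewrite -EFinD lee_fin.
  set a := complex.Re `|x i|; set b := complex.Re `|y i|.
  have ab : (complex.Re `|(x + y)%R i| ^+ 2 <= (a + b) ^+ 2)%R.
    by rewrite ler_pXn2r ?nnegrE ?addr_ge0 ?Re_norm_ge0 ?Re_normD.
  apply: (le_trans ab); rewrite -subr_ge0.
  have -> : ((1 + t) * a ^+ 2 + (1 + t^-1) * b ^+ 2 - (a + b) ^+ 2 =
             t^-1 * (t * a - b) ^+ 2)%R.
    by field; rewrite lt0r_neq0.
  by rewrite mulr_ge0 ?sqr_ge0 ?ltW.
rewrite esumD; last 2 first.
- by move=> i _; rewrite lee_fin mulr_ge0 ?sqr_ge0// addr_ge0// ltW.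
- by move=> i _; rewrite lee_fin mulr_ge0 ?sqr_ge0// addr_ge0// ltW.
apply: leeD; apply: esumZ_le => [|i]; rewrite ?sqr_ge0//.
- by rewrite addr_ge0// ltW.
- by rewrite addr_ge0// ltW.
Qed.

Let sqsumZ_le (l : R[i]) (x : I -> R[i]^o) :
  (sqsum (l *: x)%R <= (complex.Re `|l| ^+ 2)%:E * sqsum x)%E.
Proof.
rewrite /sqsum (eq_esum (b := fun i =>
  (complex.Re `|l| ^+ 2 * complex.Re `|x i| ^+ 2)%:E)); last first.
  by move=> i _; rewrite -exprMn -Re_normM.
by apply: esumZ_le => [|i]; rewrite sqr_ge0.
Qed.

Lemma sqsumZ (l : R[i]) (x : I -> R[i]^o) :
  sqsum (l *: x) = ((complex.Re `|l| ^+ 2)%:E * sqsum x)%E.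
Proof.
have [->|l0] := eqVneq l 0%R.
  rewrite scale0r normr0 expr0n mul0e; apply: esum1 => i _.
  by rewrite [X in `|X|](_ : _ = 0%R)// normr0 expr0n.
apply/eqP; rewrite eq_le sqsumZ_le/=.
have n0 : (complex.Re `|l| ^+ 2 != 0)%R.
  rewrite expf_eq0 andTb; apply: contra l0 => /eqP n0.
  by rewrite -normr_eq0 -(Re_normE l) n0.
have := sqsumZ_le l^-1%R (l *: x)%R; rewrite scalerA mulVf// scale1r => h.
apply: (@le_trans _ _ ((complex.Re `|l| ^+ 2)%:E *
   ((complex.Re `|l^-1| ^+ 2)%:E * sqsum (l *: x)))%E).
  by apply: lee_wpmul2l => //; rewrite lee_fin sqr_ge0.
rewrite muleA -EFinM -exprMn -Re_normM divff// normr1 expr1n.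
by rewrite mul1e.
Qed.

Lemma square_summableP x : reflect (sqsum x < +oo)%E (x \in square_summable).
Proof. exact: asboolP. Qed.

Lemma square_summable_submod : submod_closed square_summable.
Proof.
split.
  apply/square_summableP; rewrite /sqsum esum1 ?ltry// => i _.
  by rewrite [X in `|X|](_ : _ = 0%R)// normr0 expr0n.
move=> l x y /square_summableP x2 /square_summableP y2; apply/square_summableP.
apply: le_lt_trans (sqsumD_le _ _ ltr01) _.
have fx : sqsum x \is a fin_num by rewrite ge0_fin_numE ?sqsum_ge0.
have fy : sqsum y \is a fin_num by rewrite ge0_fin_numE ?sqsum_ge0.
by rewrite sqsumZ -ge0_fin_numE ?adde_ge0 ?mule_ge0 ?sqsum_ge0//
   ?lee_fin ?sqr_ge0 ?invr_ge0 ?addr_ge0// fin_numD !fin_numM.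
Qed.

HB.instance Definition _ :=
  GRing.isSubmodClosed.Build _ _ square_summable square_summable_submod.

End ell2_space.

Section ell2_type.
Variables (R : realType) (I : choiceType).

Record ell2 := Ell2 {
  ell2_fun :> I -> R[i]^o;
  ell2_funP : ell2_fun \in square_summable }.

HB.instance Definition _ := [isSub for ell2_fun].
HB.instance Definition _ := [Choice of ell2 by <:].
HB.instance Definition _ := [SubChoice_isSubLmodule of ell2 by <:].

Definition ell2_norm (x : ell2) : R := Num.sqrt (fine (sqsum x)).

Lemma sqsum_fin (x : ell2) : sqsum x \is a fin_num.
Proof.
by rewrite ge0_fin_numE ?sqsum_ge0//; have /square_summableP := ell2_funP x.
Qed.

Lemma ell2_norm_ge0 x : 0 <= ell2_norm x.
Proof. exact: sqrtr_ge0. Qed.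

Lemma ell2_normE x : ((ell2_norm x) ^+ 2)%:E = sqsum x.
Proof. by rewrite sqr_sqrtr ?fine_ge0 ?sqsum_ge0// fineK// sqsum_fin. Qed.

Lemma ell2_norm0_eq0 x : (ell2_norm x)%:C = 0 -> x = 0.
Proof.
move=> [x0]; apply: val_inj; apply/funext => i /=.
have : ((complex.Re `|x i| ^+ 2)%:E <= 0)%E.
  have -> : 0%E = sqsum x by rewrite -ell2_normE x0 expr0n.
  apply: esum_ge; exists [set i]; last by rewrite fsbig_set1.
  by split.
rewrite lee_fin => h; have /eqP : complex.Re `|x i| ^+ 2 = 0.
  by apply/le_anti; rewrite h sqr_ge0.
rewrite sqrf_eq0 => /eqP n0; apply/eqP; rewrite -normr_eq0.
by rewrite -[`|_|]RRe_real ?normr_real// n0.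
Qed.

Lemma ell2_normZ (l : R[i]) (x : ell2) :
  (ell2_norm (l *: x))%:C = `|l| * (ell2_norm x)%:C.
Proof.
rewrite -[`|l|]RRe_real ?normr_real// -rmorphM/=; congr (_%:C).
have l0 : 0 <= complex.Re `|l| by have := normr_ge0 l; rewrite lecE => /andP[].
apply/eqP; rewrite -(@eqrXn2 _ 2) ?ell2_norm_ge0 ?mulr_ge0 ?ell2_norm_ge0//.
rewrite -eqe ell2_normE exprMn EFinM ell2_normE.
by rewrite [X in sqsum X](_ : _ = l *: (x : I -> R[i]^o))// sqsumZ.
Qed.

Lemma ell2_normD (x y : ell2) :
  (ell2_norm (x + y))%:C <= (ell2_norm x)%:C + (ell2_norm y)%:C.
Proof.
rewrite -rmorphD/= lecR.
have [x0|nx0] := eqVneq (ell2_norm x) 0.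
  by rewrite x0 (@ell2_norm0_eq0 x) ?x0// !add0r.
have [y0|ny0] := eqVneq (ell2_norm y) 0.
  by rewrite y0 (@ell2_norm0_eq0 y) ?y0// !addr0.
have px : 0 < ell2_norm x by rewrite lt_neqAle eq_sym nx0 ell2_norm_ge0.
have py : 0 < ell2_norm y by rewrite lt_neqAle eq_sym ny0 ell2_norm_ge0.
rewrite -(@ler_pXn2r _ 2) ?nnegrE ?addr_ge0 ?ell2_norm_ge0//.
have := sqsumD_le x y (divr_gt0 py px).
rewrite [X in (X <= _)%E](_ : _ = sqsum (x + y)%R)//.
rewrite -!ell2_normE -!EFinM -EFinD lee_fin.
set a := ell2_norm x in px nx0 *; set b := ell2_norm y in py ny0 *.
move=> /le_trans; apply.
rewrite le_eqVlt; apply/orP; left; apply/eqP; field.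
by rewrite nx0 ny0.
Qed.

HB.instance Definition _ := Lmodule_isNormed.Build R[i] ell2
  ell2_normD ell2_normZ ell2_norm0_eq0.

End ell2_type.

Section operators.
Context {R : realType} {I : choiceType}.
Local Notation ell2 := (ell2 R I).
Implicit Types (T : {linear ell2 -> ell2}) (A B : I -> I -> R[i]) (p : \bar R).

(* Linear in the first argument; the family is absolutely summable, and
   [summability.sum] is its unordered sum (limit along finite subsets of I). *)
Definition dot (x y : ell2) : R[i] :=
  summability.sum (fun i => (x i * (y i)^*%C) : R[i]^o).

Lemma delta_square_summable (j : I) :
  (fun i => (i == j)%:R : R[i]^o) \in square_summable.
Proof.
apply/square_summableP; rewrite /sqsum (esumID [set j])//; last first.
  by move=> i _; rewrite lee_fin sqr_ge0.
rewrite setTI esum_set1 ?lee_fin ?sqr_ge0// [X in (_ + X)%E]esum1 ?adde0 ?ltry//.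
by move=> i [_ /eqP/negbTE ->]; rewrite normr0 expr0n.
Qed.

Definition delta (j : I) : ell2 := Ell2 (delta_square_summable j).

Definition orthonormal_basis (J : set ell2) : Prop :=
  [/\ forall u, J u -> dot u u = 1,
      forall u v, J u -> J v -> u <> v -> dot u v = 0 &
      forall x, (forall u, J u -> dot x u = 0) -> x = 0].

Definition compact_operator T : Prop :=
  precompact (T @` [set x | `|x| <= 1]).

Definition adjoint (T : ell2 -> ell2) : ell2 -> ell2 :=
  fun y => get [set z | forall x, dot (T x) y = dot x z].

(* Functional calculus: for P positive and compact and s > 0, P^s is the bounded
   operator acting as l^s on each eigenvector of eigenvalue l in an orthonormal
   basis diagonalising P. It exists by the spectral theorem and does not depend
   on the basis. *)
Definition is_operator_power (P : ell2 -> ell2) (s : R) (Q : ell2 -> ell2) :=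
  [/\ linear Q, continuous Q &
      exists2 J, orthonormal_basis J &
        forall u, J u -> exists2 l : R, 0 <= l &
          P u = l%:C *: u /\ Q u = (l `^ s)%:C *: u].

Definition operator_power (P : ell2 -> ell2) (s : R) : ell2 -> ell2 :=
  get (is_operator_power P s).

(* Only meant for positive operators, whose diagonal entries are real and
   nonnegative. *)
Definition trace (Q : ell2 -> ell2) : \bar R :=
  \esum_(i in [set: I]) (complex.Re (dot (Q (delta i)) (delta i)))%:E.

Definition operator_norm (T : ell2 -> ell2) : \bar R :=
  ereal_sup [set (ell2_norm (T x))%:E | x in [set x | `|x| <= 1]].

(* Only meant for 1 <= p; the value at -oo is irrelevant. *)
Definition schatten_norm p T : \bar R :=
  match p with
  | r%:E => (trace (operator_power (adjoint T \o T) (r / 2)) `^ r^-1)%E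
  | +oo%E => operator_norm T
  | -oo%E => 0%E
  end.

Definition schatten p : set {linear ell2 -> ell2} :=
  [set T | compact_operator T /\ (schatten_norm p T < +oo)%E].

Definition matrix_of T : I -> I -> R[i] := fun i j => T (delta j) i.

Definition schur A B : I -> I -> R[i] := fun i j => A i j * B i j.

Definition schur_multiplier p A : Prop :=
  forall T, schatten p T ->
    exists2 T', schatten p T' & matrix_of T' = schur A (matrix_of T).

(* A bounded operator is determined by its matrix, so T' below is M_A(T). *)
Definition isometric_schur_multiplier p A : Prop :=
  schur_multiplier p A /\
  forall T T', schatten p T -> schatten p T' ->
    matrix_of T' = schur A (matrix_of T) ->
    schatten_norm p T' = schatten_norm p T.

End operators.

(* Main.v *)
(* Test the multiplier on matrices supported on one entry and on a 2 x 2 block.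
   A matrix unit has norm 1, which forces |A i j| = 1. The all-ones block has
   Gram matrix with eigenvalues 4 and 0, and its image under the multiplier is
   a block with unimodular entries a, b, c, d, whose Gram matrix [[2, g], [g^*, 2]],
   g = a^* b + c^* d, has eigenvalues 2 + |g| and 2 - |g|. For p <> 2, equality of
   the Schatten norms forces |g| = 2, by strict convexity or concavity of x^(p/2)
   (for p = oo, by comparing the top eigenvalues), and |g| = 2 means ad = bc.
   Hence all 2 x 2 minors of A vanish and A has the form a_i b_j.

   The power of T^* T is only characterised by an arbitrary eigenbasis; it is
   identified with the explicit one because both are continuous and agree on a
   total orthonormal set, and a bounded functional vanishing there is zero by the
   Riesz representation of bounded functionals. *)

Require Import Defs.
From HB Require Import structures.
From mathcomp Require Import all_boot all_order all_algebra.
From mathcomp Require Import finmap.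
From mathcomp Require Import all_classical all_reals all_analysis.
From mathcomp Require Import complex.
From mathcomp Require summability.
From mathcomp Require Import ring lra.
Set Implicit Arguments.
Unset Strict Implicit.
Unset Printing Implicit Defensive.
Import Order.TTheory GRing.Theory Num.Theory.
Import numFieldNormedType.Exports.
Local Open Scope classical_set_scope.
Local Open Scope ring_scope.
Local Open Scope complex_scope.
Local Notation "z ^*" := (conjc z) : ring_scope.

#[local] Existing Instance summability.totally_filter.

(** * Finitely supported vectors of [ell2] and convergence of truncations *)

Section finite_support.
Context {R : realType} {I : choiceType}.
Local Notation C := R[i].
Local Notation ell2 := (ell2 R I).
Implicit Types (s : seq I) (x y : ell2).

Lemma Re_normK (z : C) : (complex.Re `|z|)%:C = `|z|.
Proof. by rewrite RRe_real// normr_real. Qed.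

Lemma conjcM (z w : C) : (z * w)^* = z^* * w^*.
Proof. exact: rmorphM. Qed.

Lemma conjcD (z w : C) : (z + w)^* = z^* + w^*.
Proof. exact: rmorphD. Qed.

Lemma conjcB (z w : C) : (z - w)^* = z^* - w^*.
Proof. exact: rmorphB. Qed.

Lemma mulcJ_norm (z : C) : z * z^* = (complex.Re `|z| ^+ 2)%:C.
Proof. by rewrite rmorphXn/= Re_normK sqr_normc. Qed.

Lemma finite_set_uniq_seq (F : set I) : finite_set F ->
  exists2 r : seq I, uniq r & F = [set` r].
Proof.
move=> /finite_seqP[r ->]; exists (undup r); rewrite ?undup_uniq//.
by apply/seteqP; split=> i /=; rewrite mem_undup.
Qed.

Lemma ell2P x y : (forall i, x i = y i) -> x = y.
Proof. by move=> xy; apply: val_inj; apply/funext. Qed.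

Lemma ell2_sumE (J : Type) (r : seq J) (F : J -> ell2) i :
  (\sum_(j <- r) F j) i = \sum_(j <- r) F j i.
Proof.
by elim: r => [|j r IH]; rewrite ?big_nil// !big_cons -IH.
Qed.

Lemma big_seq_widen (V : nmodType) s (r : seq I) (F : I -> V) :
  uniq s -> uniq r -> {subset s <= r} -> (forall i, i \notin s -> F i = 0) ->
  \sum_(i <- r) F i = \sum_(i <- s) F i.
Proof.
move=> us ur sr F0; rewrite (bigID (mem s))/= [X in _ + X]big1 ?addr0//.
rewrite -big_filter; apply: perm_big; apply: uniq_perm => //.
  exact: filter_uniq.
by move=> i; rewrite mem_filter; apply/andb_idr => /sr.
Qed.

Lemma ler_sum_seq s (r : seq I) (F : I -> R) : uniq s -> uniq r ->
  {subset s <= r} -> (forall i, 0 <= F i) ->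
  \sum_(i <- s) F i <= \sum_(i <- r) F i.
Proof.
move=> us ur sr F0.
rewrite (eq_big_seq (fun i => if i \in s then F i else 0)); last by move=> i ->.
rewrite -(@big_seq_widen _ s r)// => [|i /negbTE ->//].
by apply: ler_sum => i _; case: ifP.
Qed.

Lemma sum_delta_seq (V : nmodType) s (F : I -> V) i : uniq s ->
  \sum_(m <- s) F m *+ (i == m) = if i \in s then F i else 0.
Proof.
move=> us; case: ifPn => [si|nsi].
  rewrite (bigD1_seq i)//= eqxx mulr1n big1 ?addr0// => m.
  by rewrite eq_sym => /negbTE ->.
rewrite big1_seq// => m /andP[_ sm].
by case: eqP nsi => [->|//]; rewrite sm.
Qed.

Lemma sum_delta_mem (V : nmodType) s (F : I -> V) i : uniq s -> i \in s ->
  \sum_(m <- s) F m *+ (i == m) = F i.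
Proof. by move=> us si; rewrite sum_delta_seq// si. Qed.

Definition fincomb s (c : I -> C) : ell2 := \sum_(m <- s) c m *: delta m.

Lemma fincombE s c i : uniq s -> fincomb s c i = if i \in s then c i else 0.
Proof.
move=> us; rewrite /fincomb ell2_sumE -sum_delta_seq//.
by apply: eq_bigr => m _; rewrite -[_ *+ _]mulr_natr.
Qed.

Lemma partial_sumE (V : zmodType) (F : I -> V) (A : {fset I}) :
  summability.partial_sum F A = \sum_(i <- A) F i.
Proof. by rewrite big_seq_fsetE. Qed.

(** The partial sums over finite sets are constant once the set contains [s], so the unordered sum
    is that constant. *)
Lemma dot_finsupp s x y : uniq s ->
  (forall i, i \notin s -> x i * (y i)^* = 0) ->
  dot x y = \sum_(i <- s) x i * (y i)^*.
Proof.
move=> us xy0; apply: (@norm_lim_near_cst R[i] R[i]^o _ _ summability.totally_filter).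
exists [fset i | i in s]%fset => // A sA.
rewrite partial_sumE.
apply: big_seq_widen => // i si.
by have /fsubsetP := sA; apply; rewrite inE.
Qed.

Lemma dot_deltar x j : dot x (delta j) = x j.
Proof.
rewrite (@dot_finsupp [:: j])//= => [|i].
  by rewrite big_seq1 eqxx conjc1 mulr1.
by rewrite inE => /negbTE ->; rewrite conjc0 mulr0.
Qed.

Lemma dot_deltal x j : dot (delta j) x = (x j)^*.
Proof.
rewrite (@dot_finsupp [:: j])//= => [|i].
  by rewrite big_seq1 eqxx mulr1n mul1r.
by rewrite inE => /negbTE ->; rewrite mul0r.
Qed.

Lemma esum_finsupp s (f : I -> R) : uniq s -> (forall i, 0 <= f i) ->
  (forall i, i \notin s -> f i = 0) ->
  \esum_(i in [set: I]) (f i)%:E = (\sum_(i <- s) f i)%:E.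
Proof.
move=> us f0 fs; rewrite (esumID [set` s]); last by move=> i _; rewrite lee_fin.
rewrite !setTI [X in (_ + X)%E]esum1 ?adde0; last first.
  by move=> i /= /negP /fs ->.
rewrite esum_fset//; last by move=> i _; rewrite lee_fin.
by rewrite -fsbig_seq// sumEFin.
Qed.

Lemma ell2_norm_sqr_finsupp s x : uniq s -> (forall i, i \notin s -> x i = 0) ->
  ell2_norm x ^+ 2 = \sum_(i <- s) complex.Re `|x i| ^+ 2.
Proof.
move=> us xs; apply: EFin_inj; rewrite ell2_normE.
apply: esum_finsupp => // i; first exact: sqr_ge0.
by move/xs => ->; rewrite normr0 expr0n.
Qed.

Lemma ell2_norm_sqr_ge s x : uniq s ->
  \sum_(i <- s) complex.Re `|x i| ^+ 2 <= ell2_norm x ^+ 2.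
Proof.
move=> us; rewrite -lee_fin ell2_normE -sumEFin fsbig_seq//.
by apply: esum_ge; exists [set` s].
Qed.

Lemma Re_norm_ge0 (z : C) : 0 <= complex.Re `|z|.
Proof. by rewrite -ler0c Re_normK. Qed.

Lemma coord_le_norm x i : `|x i| <= `|x|.
Proof.
rewrite -Re_normK lecR -(@ler_pXn2r _ 2) ?nnegrE ?ell2_norm_ge0 ?Re_norm_ge0//.
by have := @ell2_norm_sqr_ge [:: i] x isT; rewrite big_seq1.
Qed.

(** Some finite set [r] nearly attains the supremum defining the squared norm. For [A] containing
    [r], the squared error is the tail outside [A], which is then below [e1 ^+ 2]. *)
Lemma fincomb_cvg x :
  (fun A : {fset I} => fincomb A x) @ @summability.totally I --> x.
Proof.
apply/cvgrPdist_lt => e e0.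
have [e1 ee1] : exists e1 : R, e = e1%:C.
  by apply/complex_realP; rewrite gtr0_real.
move: e0; rewrite ee1 ltcR => e10; have e20 : 0 < e1 ^+ 2 by rewrite exprn_gt0.
have [_ [F [Ffin _] <-]] := ub_ereal_sup_adherent e20 (sqsum_fin x).
rewrite -[ereal_sup _]/(sqsum x) -ell2_normE.
have [r ur ->] := finite_set_uniq_seq Ffin.
rewrite -fsbig_seq// sumEFin -EFinB lte_fin => ltF.
exists [fset i | i in r]%fset => // A rA.
rewrite [X in X < _](_ : _ = (ell2_norm (x - fincomb A x))%:C)// ltcR.
rewrite -(@ltr_pXn2r _ 2) ?nnegrE ?ell2_norm_ge0 ?ltW//.
have Ar : \sum_(i <- r) complex.Re `|x i| ^+ 2 <=
          \sum_(i <- A) complex.Re `|x i| ^+ 2.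
  apply: ler_sum_seq => // i; last exact: sqr_ge0.
  by move=> ri; apply: (fsubsetP rA); rewrite inE.
(* Pythagoras: the sum splits into [A], where the difference vanishes, and its complement, where the
   truncation vanishes. *)
suff -> : ell2_norm (x - fincomb A x) ^+ 2 =
    ell2_norm x ^+ 2 - \sum_(i <- A) complex.Re `|x i| ^+ 2 by lra.
apply/eqP; rewrite eq_sym subr_eq -eqe EFinD !ell2_normE; apply/eqP.
have pos y i : (0%R <= (complex.Re `|y i| ^+ 2)%:E)%E by rewrite lee_fin sqr_ge0.
rewrite /sqsum (esumID [set` A])// [in RHS](esumID [set` A])// !setTI.
rewrite esum_fset//.
rewrite -fsbig_seq// sumEFin addeC; congr (_ + _)%E.
rewrite [X in (X + _)%E]esum1 ?add0e; last first.
  move=> i Ai; have {}Ai : i \in A := Ai; rewrite [_ i](_ : _ = x i - fincomb A x i)// fincombE// Ai.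
  by rewrite subrr normr0 expr0n.
apply: eq_esum => i /negP/negbTE Ai; have {}Ai : (i \in A) = false := Ai.
by rewrite [(x - fincomb A x)%R i](_ : _ = x i - fincomb A x i)// fincombE// Ai subr0.
Qed.

End finite_support.

(** * Riesz representation and uniqueness of operator powers *)

Section operator_powers.
Context {R : realType} {I : choiceType}.
Local Notation C := R[i].
Local Notation ell2 := (ell2 R I).
Implicit Types (x y : ell2).

Lemma normE x : `|x| = (ell2_norm x)%:C.
Proof. by []. Qed.

(** The coordinates of the representing vector are forced to be [(phi (delta i))^*]. Testing [phi]
    on finite truncations of this family shows square summability, and the formula passes from
    truncations of [x] to [x] by continuity of [phi]. *)
Lemma bounded_riesz (phi : {linear ell2 -> R[i]^o}) (M : R) :
  0 <= M -> (forall x, `|phi x| <= M%:C * `|x|) ->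
  exists z, forall x, dot z x = (phi x)^*.
Proof.
move=> M0 phiM; pose z i : R[i]^o := (phi (delta i))^*.
have zM s : uniq s -> \sum_(i <- s) complex.Re `|z i| ^+ 2 <= M ^+ 2.
  move=> us; set S := \sum_(i <- s) _.
  have S0 : 0 <= S by apply: sumr_ge0 => i _; apply: sqr_ge0.
  (* For this test vector [phi w] is the squared norm of [w], so boundedness gives ||w||^2 <= M
     ||w||, hence ||w|| <= M. *)
  pose w := fincomb s z.
  have nw : ell2_norm w ^+ 2 = S.
    rewrite (@ell2_norm_sqr_finsupp _ _ s)//; last first.
      by move=> i /negbTE si; rewrite fincombE// si.
    by apply: eq_big_seq => i si; rewrite fincombE// si.
  have : phi w = S%:C.
    rewrite /w /fincomb linear_sum rmorph_sum; apply: eq_bigr => i _ /=.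
    by rewrite linearZ/= -mulcJ_norm conjcK.
  have := phiM w => /[swap] ->; rewrite normE normc_def/= expr0n addr0.
  rewrite sqrtr_sqr ger0_norm// -rmorphM/= lecR => SM.
  have [S_eq0|S_neq0] := eqVneq S 0; first by rewrite S_eq0 sqr_ge0.
  have nw_gt0 : 0 < ell2_norm w.
    by rewrite lt_neqAle ell2_norm_ge0 eq_sym andbT -sqrf_eq0 nw.
  move: SM; rewrite -nw expr2 ler_pM2r// => nwM.
  by rewrite -expr2 ler_pXn2r// nnegrE ltW.
have zsum : z \in square_summable.
  apply/square_summableP; apply: (@le_lt_trans _ _ (M ^+ 2)%:E); last exact: ltry.
  apply: ge_ereal_sup => _ [F [Ffin _] <-].
  have [r ur ->] := finite_set_uniq_seq Ffin.
  by rewrite -fsbig_seq// sumEFin lee_fin zM.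
exists (Ell2 zsum) => x; rewrite /dot /summability.sum.
apply: (@cvg_lim R[i]^o); first exact: norm_hausdorff.
have phi_cont : continuous phi.
  apply/bounded_linear_continuous/linear_boundedP.
  exists M%:C; split=> [|r Mr y]; first by apply/complex_realP; exists M.
  by apply: le_trans (phiM y) _; rewrite ler_wpM2r// ltW.
apply/cvgrPdist_lt => e e0.
have /cvgrPdist_lt/(_ _ e0) := cvg_comp _ _ (@fincomb_cvg R I x) (phi_cont x).
apply: filterS => A; rewrite -normcJ rmorphB/=; congr (Num.norm (_ - _) < _).
rewrite partial_sumE /fincomb linear_sum rmorph_sum/=; apply: eq_bigr => i _.
by rewrite linearZ/= rmorphM/= mulrC.
Qed.

Lemma continuous_linear_bound (D : {linear ell2 -> ell2}) : continuous D ->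
  exists2 M : R, 0 <= M & forall x, `|D x| <= M%:C * `|x|.
Proof.
move=> /linear_bounded_continuous/linear_boundedP/pinfty_ex_gt0[M M0 DM].
have /complex_realP[M' MM'] : M \is Num.real by rewrite gtr0_real.
by exists M'; rewrite -?lecR -MM'// ltW.
Qed.

Lemma operator_norm_lty (D : {linear ell2 -> ell2}) :
  continuous D -> (operator_norm D < +oo)%E.
Proof.
move=> /continuous_linear_bound[M M0 DM].
apply: (@le_lt_trans _ _ M%:E); last exact: ltry.
apply: ge_ereal_sup => _ [x /= x1 <-]; rewrite lee_fin -lecR.
by apply: le_trans (DM x) _; rewrite -[leRHS]mulr1 ler_wpM2l// ler0c.
Qed.

(** Each coordinate of [D] is a bounded functional; its Riesz vector is orthogonal to [J], hence
    zero by totality. *)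
Lemma continuous_linear_eq0 (D : {linear ell2 -> ell2}) (J : set ell2) :
  continuous D -> (forall x, (forall u, J u -> dot x u = 0) -> x = 0) ->
  (forall u, J u -> D u = 0) -> forall x, D x = 0.
Proof.
move=> /continuous_linear_bound[M M0 DM] Jtotal DJ x; apply: ell2P => i.
pose phi y : R[i]^o := D y i.
have lphi : linear phi by move=> a u v; rewrite /phi linearP.
pose Phi : {linear ell2 -> R[i]^o} := HB.pack phi (GRing.isLinear.Build _ _ _ _ _ lphi).
have [|z zE] := @bounded_riesz Phi M M0.
  by move=> y; apply: le_trans (DM y); exact: coord_le_norm.
suff z0 : z = 0.
  have := zE x; rewrite z0 => /(congr1 conjc); rewrite conjcK => DE; rewrite -[LHS]/(Phi x) -DE.
  rewrite (@dot_finsupp _ _ [::])// ?big_nil ?conjc0// => j _.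
  by rewrite mul0r.
by apply: Jtotal => u Ju; rewrite zE/= /phi DJ// conjc0.
Qed.

(** The eigenbasis [J'] behind the chosen power is unknown, which is why [Q] must act as l^s on
    every eigenvector of [P] and not only on those in [J]. The two operators then agree on [J'], and
    [J'] is total. *)
Lemma operator_power_eq (P Q : ell2 -> ell2) (s : R) :
  linear Q -> continuous Q ->
  (forall (l : R) u, 0 <= l -> P u = l%:C *: u -> Q u = (l `^ s)%:C *: u) ->
  (exists2 J, orthonormal_basis J &
     forall u, J u -> exists2 l : R, 0 <= l & P u = l%:C *: u) ->
  operator_power P s = Q.
Proof.
move=> lQ cQ PQ [J onbJ PJ].
have powQ : is_operator_power P s Q.
  split=> //; exists J => // u /PJ[l l0 Pu]; exists l => //.
  by split=> //; exact: PQ.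
have [lQ' cQ' [J' [_ _ J'total] PQ']] := @getPex _ _ (ex_intro _ Q powQ).
rewrite -/(operator_power P s) in lQ' cQ' PQ' *.
set Q' := operator_power P s in lQ' cQ' PQ' *.
pose D x := Q' x - Q x.
have lD : linear D.
  by move=> a u v; rewrite /D lQ lQ' scalerBr opprD addrACA.
pose LD : {linear ell2 -> ell2} := HB.pack D (GRing.isLinear.Build _ _ _ _ _ lD).
have cD : continuous (D : ell2 -> ell2).
  by move=> x; apply: (@cvgB _ ell2 _ (nbhs x)); [exact: cQ'|exact: cQ].
apply/funext => x; apply/eqP; rewrite -subr_eq0; apply/eqP.
apply: (@continuous_linear_eq0 LD _ cD J'total) => u /PQ'[l l0 [Pu Q'u]].
by rewrite /= /D Q'u (PQ l)// subrr.
Qed.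

End operator_powers.

(** * Finite matrices as operators: continuity, compactness, adjoint, trace *)

Section finite_operators.
Context {R : realType} {I : choiceType}.
Local Notation C := R[i].
Local Notation ell2 := (ell2 R I).
Implicit Types (s : seq I) (B D : I -> I -> C) (x y : ell2).

(** [B] stays indexed by all of [I], although only its block [s1] x [s2] counts, so that Schur
    products need no reindexing. *)
Definition finop s1 s2 B x : ell2 :=
  fincomb s1 (fun m => \sum_(n <- s2) B m n * x n).

Lemma finop_linear s1 s2 B : linear (finop s1 s2 B).
Proof.
move=> a x y; rewrite /finop /fincomb scaler_sumr -big_split.
apply: eq_bigr => m _ /=; rewrite scalerA -scalerDl; congr (_ *: _).
rewrite mulr_sumr -big_split; apply: eq_bigr => n _ /=.
by rewrite mulrCA -mulrDr.
Qed.

HB.instance Definition _ s1 s2 B :=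
  GRing.isLinear.Build _ _ _ _ (finop s1 s2 B) (finop_linear s1 s2 B).

Lemma finopE s1 s2 B x m : uniq s1 ->
  finop s1 s2 B x m = if m \in s1 then \sum_(n <- s2) B m n * x n else 0.
Proof. exact: fincombE. Qed.

Lemma eq_finop s1 s2 B D :
  {in s1 & s2, forall m n, B m n = D m n} -> finop s1 s2 B = finop s1 s2 D.
Proof.
move=> BD; apply/funext => x; apply: eq_big_seq => m ms.
by congr (_ *: _); apply: eq_big_seq => n ns; rewrite BD.
Qed.

Lemma finop_coef_le s2 B x m :
  `|\sum_(n <- s2) B m n * x n| <= (\sum_(n <- s2) `|B m n|) * `|x|.
Proof.
rewrite (le_trans (ler_norm_sum _ _ _))// mulr_suml; apply: ler_sum => n _.
by rewrite normrM ler_wpM2l// coord_le_norm.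
Qed.

Lemma finop_continuous s1 s2 B : continuous (finop s1 s2 B).
Proof.
apply/(@bounded_linear_continuous C ell2 ell2)/linear_boundedP.
have M0 m : 0 <= (\sum_(n <- s2) `|B m n|) * `|@delta R I m|.
  by rewrite mulr_ge0// sumr_ge0.
exists (\sum_(m <- s1) (\sum_(n <- s2) `|B m n|) * `|@delta R I m|).
split=> [|r Mr x]; first by rewrite ger0_real// sumr_ge0.
apply: (@le_trans _ _ ((\sum_(m <- s1) (\sum_(n <- s2) `|B m n|) *
  `|@delta R I m|) * `|x|)); last by rewrite ler_wpM2r// ltW.
rewrite (le_trans (ler_norm_sum _ _ _))// mulr_suml; apply: ler_sum => m _.
by rewrite normrZ mulrAC ler_wpM2r// finop_coef_le.
Qed.

Lemma real_complex_continuous : continuous (fun a : R => a%:C : R[i]^o).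
Proof.
move=> a; apply/cvgrPdist_lt => e e0.
have /complex_realP[e1 ee1] : e \is Num.real by rewrite gtr0_real.
move: e0; rewrite ee1 ltcR => e10.
near=> t; rewrite -rmorphB normc_def/= expr0n addr0 sqrtr_sqr ltcR.
by near: t; apply/(@nbhs_normP R R^o); exists e1.
Unshelve. all: by end_near. Qed.

(** The disc of radius [M] lies in the square of half-side [r], and (a, b, w) -> (a + ib) v + w maps
    the compact product of that square with [K] continuously onto a compact set. *)
Lemma compact_discD (V : normedModType C) (v : V) (K : set V) (M : C) :
  compact K -> exists2 K' : set V, compact K' &
    forall (c : C) w, `|c| <= M -> K w -> K' (c *: v + w).
Proof.
move=> cK; pose r := complex.Re M.
pose Q : set (R * R * V) := (`[- r, r] `*` `[- r, r]) `*` K.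
pose f (p : R * R * V) : V := (p.1.1%:C + 'i * p.1.2%:C) *: v + p.2.
exists (f @` Q).
  apply: continuous_compact; last first.
    by do 2!apply: compact_setX => //; exact: segment_compact.
  apply: continuous_subspaceT => p.
  have cp1 : p0.1.1%:C @[p0 --> p] --> (p.1.1%:C : R[i]^o).
    apply: (@cvg_comp _ _ _ (fun q : R * R * V => q.1.1) _ _ (nbhs p.1.1)).
      by apply: cvg_comp; [exact: cvg_fst|exact: cvg_fst].
    exact: real_complex_continuous.
  have cp2 : p0.1.2%:C @[p0 --> p] --> (p.1.2%:C : R[i]^o).
    apply: (@cvg_comp _ _ _ (fun q : R * R * V => q.1.2) _ _ (nbhs p.1.2)).
      by apply: cvg_comp; [exact: cvg_fst|exact: cvg_snd].
    exact: real_complex_continuous.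
  apply: cvgD; last exact: cvg_snd.
  apply: cvgZr_tmp.
  apply: (@cvgD _ R[i]^o _ _ _ _ _ _ _ cp1).
  exact: (@cvgMl_tmp R[i] _ _ _ _ _ _ cp2).
move=> c w cM Kw; exists ((complex.Re c, complex.Im c), w); last first.
  by rewrite /f /= [in RHS](complexE c).
have cr : Num.sqrt (complex.Re c ^+ 2 + complex.Im c ^+ 2) <= r.
  by move: cM; rewrite lecE normc_def => /andP[].
split=> //; move: cr; case: c {cM} => a b /= cr; split => /=;
  rewrite in_itv/= -ler_norml; apply: le_trans cr; rewrite -sqrtr_sqr ler_wsqrtr//.
  by rewrite lerDl sqr_ge0.
by rewrite lerDr sqr_ge0.
Qed.

(** Induction on [s]: each new direction [delta m] contributes a disc of coefficients. *)
Lemma compact_fincomb s (M : I -> C) : exists2 K : set ell2, compact K &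
  forall c : I -> C, {in s, forall m, `|c m| <= M m} -> K (fincomb s c).
Proof.
elim: s => [|m s [K cK Ks]].
  by exists [set 0] => [|c _]; [exact: compact_set1|rewrite /fincomb big_nil].
have [K' cK' K's] := compact_discD (delta m) (M m) cK.
exists K' => // c cM; rewrite /fincomb big_cons; apply: K's.
  by apply: cM; rewrite mem_head.
by apply: Ks => n ns; apply: cM; rewrite inE ns orbT.
Qed.

(** On the unit ball, each coefficient of the image is bounded by the sum of the absolute values in
    its row. *)
Lemma finop_compact s1 s2 B : compact_operator (finop s1 s2 B).
Proof.
have [K cK Ks1] := compact_fincomb s1 (fun m => \sum_(n <- s2) `|B m n|).
apply: (@precompact_subset _ _ K); last first.
  by apply: compact_precompact => //; exact: norm_hausdorff.
move=> _ [x x1 <-]; apply: Ks1 => m _; apply: le_trans (finop_coef_le _ _ _ _) _.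
by rewrite -[leRHS]mulr1 ler_wpM2l// sumr_ge0.
Qed.

Lemma dot_finop s1 s2 B x y : uniq s1 -> uniq s2 ->
  dot (finop s1 s2 B x) y = dot x (finop s2 s1 (fun n m => (B m n)^*) y).
Proof.
move=> us1 us2; rewrite (dot_finsupp us1); last first.
  by move=> i /negbTE si; rewrite finopE// si mul0r.
rewrite (dot_finsupp us2); last first.
  by move=> i /negbTE si; rewrite finopE// si conjc0 mulr0.
rewrite [LHS](eq_big_seq (fun m => \sum_(n <- s2) B m n * x n * (y m)^*)).
  rewrite exchange_big; apply: eq_big_seq => n ns /=.
  rewrite finopE// ns rmorph_sum mulr_sumr; apply: eq_bigr => m _ /=.
  by rewrite rmorphM/= conjcK mulrCA mulrA.
by move=> m ms; rewrite finopE// ms mulr_suml.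
Qed.

(** [adjoint] only picks some vector with the adjoint property; testing against every [delta i]
    fixes all its coordinates. *)
Lemma adjoint_finop s1 s2 B : uniq s1 -> uniq s2 ->
  adjoint (finop s1 s2 B) = finop s2 s1 (fun n m => (B m n)^*).
Proof.
move=> us1 us2; apply/funext => y.
have ex : exists z, forall x, dot (finop s1 s2 B x) y = dot x z.
  by exists (finop s2 s1 (fun n m => (B m n)^*) y) => x; exact: dot_finop.
have zE := getPex ex.
apply: ell2P => i; apply: (can_inj (@conjcK _)).
by rewrite -!dot_deltal -dot_finop// zE.
Qed.

Lemma finop_comp s1 s2 s3 B D : uniq s2 ->
  finop s1 s2 B \o finop s2 s3 D =
  finop s1 s3 (fun i k => \sum_(j <- s2) B i j * D j k).
Proof.
move=> us2; apply/funext => x; apply: eq_bigr => m _; congr (_ *: _).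
under [RHS]eq_bigr do rewrite mulr_suml.
rewrite exchange_big; apply: eq_big_seq => j js /=.
by rewrite finopE// js mulr_sumr; apply: eq_bigr => n _; rewrite mulrA.
Qed.

Lemma finop_delta s1 s2 B m n : uniq s1 -> uniq s2 ->
  finop s1 s2 B (delta n) m = B m n *+ ((m \in s1) && (n \in s2)).
Proof.
move=> us1 us2; rewrite finopE//; case: (m \in s1) => //=.
rewrite mulrb -(sum_delta_seq (B m) n us2); apply: eq_bigr => k _.
by rewrite /= mulr_natr eq_sym.
Qed.

Lemma trace_finop s D : uniq s -> {in s, forall m, 0 <= complex.Re (D m m)} ->
  trace (finop s s D) = (\sum_(m <- s) complex.Re (D m m))%:E.
Proof.
move=> us D0; rewrite /trace.
under eq_esum do rewrite dot_deltar finop_delta// andbb.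
rewrite (@esum_finsupp _ _ s)// => [|i|i /negbTE ->//].
  by congr (_%:E); apply: eq_big_seq => m ms; rewrite ms.
by have [/D0|//] := boolP (i \in s); rewrite mulrb.
Qed.

End finite_operators.

(** * Powers, traces and norms from a unitary diagonalisation *)

Section diagonalized_operators.
Context {R : realType} {I : choiceType}.
Local Notation C := R[i].
Local Notation ell2 := (ell2 R I).
Variables (s : seq I) (V : I -> I -> C).
Hypothesis us : uniq s.
Hypothesis V_col : {in s &, forall k l,
  \sum_(m <- s) V m k * (V m l)^* = (k == l)%:R}.
Hypothesis V_row : {in s &, forall m n,
  \sum_(k <- s) V m k * (V n k)^* = (m == n)%:R}.
Implicit Types (lam : I -> R) (x : ell2).

(** This is V diag(lam) V^*; [V_col] and [V_row] say that [V] is unitary on the block. *)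
Definition diagonalized lam (m n : I) : C :=
  \sum_(k <- s) (lam k)%:C * (V m k * (V n k)^*).

(** The vector V^* x, that is, the coordinates of [x] in the basis of columns of [V]. *)
Let coef x k : C := \sum_(n <- s) (V n k)^* * x n.

Let diagonalizedE lam x m :
  \sum_(n <- s) diagonalized lam m n * x n =
  \sum_(k <- s) (lam k)%:C * (V m k * coef x k).
Proof.
under eq_bigr do rewrite mulr_suml.
rewrite exchange_big; apply: eq_bigr => k _ /=.
by rewrite !mulr_sumr; apply: eq_bigr => n _; rewrite !mulrA.
Qed.

Let sum_V_coef x : {in s, forall m, \sum_(k <- s) V m k * coef x k = x m}.
Proof.
move=> m ms; under eq_bigr do rewrite mulr_sumr.
rewrite exchange_big /= -[RHS](sum_delta_mem x us ms); apply: eq_big_seq => n ns.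
under eq_bigr do rewrite mulrA.
by rewrite -mulr_suml V_row// mulr_natl.
Qed.

Let coef_sum (c : I -> C) k : k \in s ->
  \sum_(n <- s) (V n k)^* * (\sum_(l <- s) V n l * c l) = c k.
Proof.
move=> ks; under eq_bigr do rewrite mulr_sumr.
rewrite exchange_big /= -[RHS](sum_delta_mem c us ks); apply: eq_big_seq => l ls.
under eq_bigr do rewrite mulrA [_^* * _]mulrC.
by rewrite -mulr_suml V_col// mulr_natl eq_sym.
Qed.

Let P lam := finop s s (diagonalized lam).

Let coef_P lam x k : k \in s -> coef (P lam x) k = (lam k)%:C * coef x k.
Proof.
move=> ks; rewrite -[RHS](coef_sum (fun k => (lam k)%:C * coef x k))//.
apply: eq_big_seq => n ns; rewrite finopE// ns diagonalizedE; congr (_ * _).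
by apply: eq_bigr => l _; rewrite mulrCA.
Qed.

Let quadratic lam x :
  \sum_(n <- s) x n * (P lam x n)^* =
  \sum_(k <- s) ((lam k) * complex.Re `|coef x k| ^+ 2)%:C.
Proof.
rewrite (eq_big_seq (fun n => \sum_(k <- s)
    x n * ((lam k)%:C * (V n k * coef x k))^*)); last first.
  by move=> n ns; rewrite finopE// ns diagonalizedE rmorph_sum mulr_sumr.
rewrite exchange_big; apply: eq_bigr => k _ /=.
rewrite rmorphM/= -mulcJ_norm [X in _ = _ * (X * _)]/coef mulr_suml mulr_sumr.
apply: eq_bigr => n _; rewrite !conjcM conjc_real mulrCA; congr (_ * _).
by rewrite mulrCA mulrA.
Qed.

(** The case lam = 1 of [quadratic], where the diagonalised operator is the identity on the
    block. *)
Let parseval x :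
  \sum_(k <- s) complex.Re `|coef x k| ^+ 2 =
  \sum_(n <- s) complex.Re `|x n| ^+ 2.
Proof.
apply: complexI; rewrite !rmorph_sum/=.
have := quadratic (fun=> 1) x; under [RHS]eq_bigr do rewrite mul1r.
move=> <-; apply: eq_big_seq => n ns; rewrite -mulcJ_norm; congr (_ * _^*).
rewrite finopE// ns diagonalizedE -[RHS]sum_V_coef//.
by apply: eq_bigr => k _; rewrite mul1r.
Qed.

(** The columns of [V] span only the block; the [delta m] outside it, killed by [P], complete them
    to a basis of the whole space. *)
Let eigenbasis : set ell2 := [set u |
  (exists2 k, k \in s & u = fincomb s (V^~ k)) \/
  (exists2 m, m \notin s & u = delta m)].

Let dot_eigen x k : k \in s ->
  dot x (fincomb s (V^~ k)) = \sum_(n <- s) x n * (V n k)^*.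
Proof.
move=> ks; rewrite (dot_finsupp us); last first.
  by move=> i /negbTE si; rewrite fincombE// si conjc0 mulr0.
by apply: eq_big_seq => n ns; rewrite fincombE// ns.
Qed.

Let orthonormal_eigenbasis : orthonormal_basis eigenbasis.
Proof.
split.
- move=> _ [[k ks ->]|[m ms ->]]; last by rewrite dot_deltar/= eqxx.
  rewrite dot_eigen// (eq_big_seq (fun n => V n k * (V n k)^*)).
    by rewrite V_col// eqxx.
  by move=> n ns; rewrite fincombE// ns.
- move=> _ _ [[k ks ->]|[m ms ->]] [[l ls ->]|[n ns ->]].
  + move=> kl; rewrite dot_eigen// (eq_big_seq (fun n => V n k * (V n l)^*)).
      by rewrite V_col//; case: eqP => // E; rewrite E in kl.
    by move=> n ns; rewrite fincombE// ns.
  + by rewrite dot_deltar fincombE// (negbTE ns).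
  + by rewrite dot_deltal fincombE// (negbTE ms) conjc0.
  + by move=> mn; rewrite dot_deltar/=; case: eqP => // E; rewrite E in mn.
- move=> x x0; apply: ell2P => m; have [ms|ms] := boolP (m \in s); last first.
    by rewrite -dot_deltar x0//; right; exists m.
  rewrite -sum_V_coef// big_seq big1// => k ks.
  suff -> : coef x k = 0 by rewrite mulr0.
  have <- : dot x (fincomb s (V^~ k)) = 0 by apply: x0; left; exists k.
  by rewrite dot_eigen//; apply: eq_bigr => n _; rewrite mulrC.
Qed.

(** If [u] is any eigenvector of eigenvalue [l], comparing coordinates in the columns of [V] gives
    lam k = l wherever [coef u k] is nonzero, so the candidate power acts on [u] as l^q. *)
Lemma operator_power_diagonalized lam (q : R) : q != 0 ->
  (forall k, 0 <= lam k) ->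
  operator_power (finop s s (diagonalized lam)) q =
  finop s s (diagonalized (fun k => lam k `^ q)).
Proof.
move=> q0 lam0; apply: operator_power_eq.
- exact: finop_linear.
- exact: finop_continuous.
- move=> l u l0 Pu; apply: ell2P => m; rewrite finopE//.
  have um : (l%:C *: u : ell2) m = l%:C * u m by [].
  (* Off the block [P] vanishes, so either [u m] is 0 or [l] is; in the latter case [q != 0] makes
     0^q equal to 0. *)
  case: ifPn => ms; last first.
    have : P lam u m = 0 by rewrite finopE// (negbTE ms).
    rewrite /P Pu um => /eqP; rewrite mulf_eq0 => /orP[/eqP[->]|/eqP u0].
      by rewrite powR0// scale0r.
    by rewrite [RHS](_ : _ = (l `^ q)%:C * u m)// u0 mulr0.
  rewrite [RHS](_ : _ = (l `^ q)%:C * u m)// -[u m]sum_V_coef// diagonalizedE.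
  rewrite mulr_sumr; apply: eq_big_seq => k ks; rewrite mulrCA [RHS]mulrCA.
  congr (_ * _); have [->|c0] := eqVneq (coef u k) 0; first by rewrite !mulr0.
  suff -> : lam k = l by [].
  apply: complexI; apply: (mulIf c0); rewrite -coef_P// /P Pu.
  by rewrite /coef mulr_sumr; apply: eq_bigr => n _; rewrite mulrCA.
- exists eigenbasis; first exact: orthonormal_eigenbasis.
  move=> _ [[k ks ->]|[m ms ->]]; last first.
    exists 0 => //; apply: ell2P => i; rewrite scale0r finopE//.
    case: ifP => // si; rewrite big_seq big1// => n ns /=.
    by case: eqP ms ns => [->/negbTE->//|]; rewrite mulr0.
  exists (lam k) => //; apply: ell2P => m; rewrite finopE// diagonalizedE.
  rewrite [RHS](_ : _ = (lam k)%:C * fincomb s (V^~ k) m)// fincombE//.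
  case: ifPn => ms; last by rewrite mulr0.
  rewrite -[RHS](sum_delta_mem (fun k => (lam k)%:C * V m k) us ks).
  apply: eq_big_seq => l ls; rewrite -mulr_natr -!mulrA; do 2!congr (_ * _).
  rewrite -V_col// /coef; apply: eq_big_seq => n ns.
  by rewrite fincombE// ns mulrC.
Qed.

(** Exchanging the sums leaves the squared norms of the columns of [V], which are 1. *)
Lemma trace_diagonalized lam : (forall k, 0 <= lam k) ->
  trace (finop s s (diagonalized lam)) = (\sum_(k <- s) lam k)%:E.
Proof.
move=> lam0.
have dE m : diagonalized lam m m =
    (\sum_(k <- s) lam k * complex.Re `|V m k| ^+ 2)%:C.
  by rewrite rmorph_sum; apply: eq_bigr => k _; rewrite rmorphM/= -mulcJ_norm.
rewrite trace_finop// => [|m _].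
  congr (_%:E); under eq_bigr do rewrite dE/=.
  rewrite exchange_big; apply: eq_big_seq => k ks /=.
  rewrite -mulr_sumr -[RHS]mulr1; congr (_ * _); apply: complexI.
  rewrite rmorph_sum/= [RHS](_ : _ = (k == k)%:R); last by rewrite eqxx.
  rewrite -V_col//.
  by apply: eq_bigr => m _; rewrite mulcJ_norm.
by rewrite dE/= sumr_ge0// => k _; rewrite mulr_ge0// sqr_ge0.
Qed.

Variables (s1 : seq I) (B : I -> I -> C) (lam : I -> R).
Hypothesis us1 : uniq s1.
Hypothesis lam0 : forall k, 0 <= lam k.
Hypothesis BB : {in s &, forall m n,
  \sum_(i <- s1) (B i m)^* * B i n = diagonalized lam m n}.

Let adjointB : adjoint (finop s1 s B) \o finop s1 s B =
  finop s s (diagonalized lam).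
Proof. by rewrite adjoint_finop// finop_comp//; apply: eq_finop. Qed.

(** By [BB] the [lam k] are the squared singular values of the block, whence the exponent r/2. *)
Lemma schatten_norm_finop (r : R) : r != 0 ->
  schatten_norm r%:E (finop s1 s B) =
  ((\sum_(k <- s) lam k `^ (r / 2)) `^ r^-1)%:E.
Proof.
move=> r0; rewrite /= adjointB operator_power_diagonalized//; last first.
  by rewrite mulf_neq0// invr_neq0.
by rewrite trace_diagonalized// => k; exact: powR_ge0.
Qed.

Let norm_sqrB x : ell2_norm (finop s1 s B x) ^+ 2 =
  \sum_(k <- s) lam k * complex.Re `|coef x k| ^+ 2.
Proof.
apply: complexI; rewrite rmorph_sum/= -quadratic.
rewrite (@ell2_norm_sqr_finsupp _ _ s1)//; last first.
  by move=> i /negbTE si; rewrite finopE// si.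
transitivity (dot (finop s1 s B x) (finop s1 s B x)).
  rewrite (dot_finsupp us1) => [|i /negbTE si]; last by rewrite finopE// si mul0r.
  by rewrite rmorph_sum; apply: eq_bigr => i _; rewrite mulcJ_norm.
rewrite dot_finop// -adjoint_finop// -[adjoint _ _]/((_ \o _) x) adjointB.
rewrite (dot_finsupp us)// => i /negbTE si.
by rewrite finopE// si conjc0 mulr0.
Qed.

(** In eigen-coordinates [norm_sqrB] and [parseval] give the upper bound; it is attained at the
    [k]-th column of [V]. *)
Lemma operator_norm_finop k : k \in s -> {in s, forall l, lam l <= lam k} ->
  operator_norm (finop s1 s B) = (Num.sqrt (lam k))%:E.
Proof.
move=> ks lamk; apply/eqP; rewrite eq_le; apply/andP; split.
  apply: ge_ereal_sup => _ [x /= x1 <-]; rewrite lee_fin.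
  move: x1; rewrite normE lecR => x1.
  rewrite -(@ler_pXn2r _ 2) ?nnegrE ?ell2_norm_ge0 ?sqrtr_ge0// (sqr_sqrtr (lam0 k)).
  rewrite [leLHS]norm_sqrB.
  apply: (@le_trans _ _ (\sum_(l <- s) lam k * complex.Re `|coef x l| ^+ 2)).
    rewrite big_seq [leRHS]big_seq; apply: ler_sum => l ls.
    by rewrite ler_wpM2r ?sqr_ge0// lamk.
  rewrite -mulr_sumr parseval -[leRHS]mulr1 ler_wpM2l//.
  by rewrite (le_trans (ell2_norm_sqr_ge x us))// exprn_ile1 ?ell2_norm_ge0.
apply: ereal_sup_ubound; exists (fincomb s (V^~ k)) => /=.
  rewrite normE lecR -(@ler_pXn2r _ 2) ?nnegrE ?ell2_norm_ge0// expr1n.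
  rewrite (@ell2_norm_sqr_finsupp _ _ s)//; last first.
    by move=> i /negbTE si; rewrite fincombE// si.
  rewrite -lecR rmorph_sum/= (eq_big_seq (fun n => V n k * (V n k)^*)).
    by rewrite V_col// eqxx.
  by move=> n ns; rewrite fincombE// ns mulcJ_norm.
congr (_%:E); apply/eqP; rewrite -(@eqrXn2 _ 2) ?ell2_norm_ge0 ?sqrtr_ge0//.
rewrite (sqr_sqrtr (lam0 k)) [eqbLHS]norm_sqrB.
have cE l : l \in s -> coef (fincomb s (V^~ k)) l = (k == l)%:R.
  move=> ls; rewrite -V_col//; apply: eq_big_seq => n ns.
  by rewrite fincombE// ns mulrC.
rewrite -[eqbRHS](sum_delta_mem lam us ks).
apply/eqP; apply: eq_big_seq => l ls; rewrite cE// normr_nat -[RHS]mulr_natr.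
by congr (_ * _); case: (k == l); rewrite /= ?expr1n ?expr0n.
Qed.

Lemma finop_schatten p : (0 < p)%E -> schatten p (finop s1 s B).
Proof.
move=> p0; split; first exact: finop_compact.
case: p p0 => [r| |//]; rewrite ?lte_fin => r0.
  by rewrite schatten_norm_finop ?ltry// gt_eqF.
by apply: operator_norm_lty; exact: finop_continuous.
Qed.

End diagonalized_operators.

(** * Finite test matrices and unimodularity of the entries *)

Section schur_multipliers.
Context {R : realType} {I : choiceType}.
Local Notation C := R[i].
Variables (p : \bar R) (A : I -> I -> C).
Hypothesis p1 : (1%:E <= p)%E.
Hypothesis A_isom : isometric_schur_multiplier p A.

Let p_gt0 : (0 < p)%E.
Proof. exact: lt_le_trans p1. Qed.

Lemma isometric_finop (s1 s2 : seq I) (B : I -> I -> C) :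
  uniq s1 -> uniq s2 ->
  schatten p (finop s1 s2 B) -> schatten p (finop s1 s2 (schur A B)) ->
  schatten_norm p (finop s1 s2 (schur A B)) = schatten_norm p (finop s1 s2 B).
Proof.
move=> us1 us2 pB pAB; apply: A_isom.2 => //.
apply/funext => m; apply/funext => n; rewrite /matrix_of /schur !finop_delta//.
by rewrite mulrnAr.
Qed.

Lemma isometric_unimodular i j : `|A i j| = 1.
Proof.
(* A 1 x 1 block is diagonalised by V = 1, with the single squared singular value |B i j|^2. *)
pose lam (B : I -> I -> C) := fun _ : I => complex.Re `|B i j| ^+ 2.
have u1 (m : I) : uniq [:: m] by [].
have col : {in [:: j] &, forall k l,
    \sum_(m <- [:: j]) 1 * (1 : C)^* = (k == l)%:R}.
  by move=> k l; rewrite !inE big_seq1 => /eqP-> /eqP->; rewrite eqxx conjc1 mulr1.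
have BB B : {in [:: j] &, forall m n, \sum_(k <- [:: i]) (B k m)^* * B k n =
    diagonalized [:: j] (fun _ _ => 1) (lam B) m n}.
  move=> m n; rewrite !inE => /eqP-> /eqP->; rewrite /diagonalized !big_seq1.
  by rewrite conjc1 !mulr1 mulrC mulcJ_norm.
have lam0 B (k : I) : 0 <= lam B k by exact: sqr_ge0.
have sch B : schatten p (finop [:: i] [:: j] B).
  exact: (finop_schatten (u1 j) col col (u1 i) (lam0 B) (BB B)).
have := isometric_finop (u1 i) (u1 j) (sch (fun _ _ => 1)) (sch _).
have -> : schur A (fun _ _ => 1) = A.
  by apply/funext => m; apply/funext => n; rewrite /schur mulr1.
suff h : schatten_norm p (finop [:: i] [:: j] A) =
         schatten_norm p (finop [:: i] [:: j] (fun _ _ => 1)) ->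
         complex.Re `|A i j| ^+ 2 = 1.
  move/h => /eqP; rewrite sqrp_eq1 ?Re_norm_ge0// => /eqP A1.
  by rewrite -Re_normK A1.
have l1 k : lam (fun _ _ => 1) k = 1 by rewrite /lam normr1 expr1n.
case: p p_gt0 => [r| |//]; rewrite ?lte_fin => r0.
  have rN0 : r != 0 by rewrite gt_eqF.
  rewrite !(schatten_norm_finop (u1 j) col col (u1 i) (lam0 _) (BB _))//.
  rewrite !big_seq1 l1 => -[].
  (* The outer exponent 1/r is removed first, then the inner exponent r/2; both are positive. *)
  move/powR_injective; rewrite invr_gt0 !nnegrE !powR_ge0 => /(_ r0 isT isT).
  move/powR_injective; rewrite divr_gt0// !nnegrE ler01 lam0.
  by move=> /(_ isT isT isT).
have jl B : {in [:: j], forall l, lam B l <= lam B j} by move=> l _.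
have jj : j \in [:: j] by rewrite inE.
rewrite /= !(operator_norm_finop (u1 j) col col (u1 i) (lam0 _) (BB _) jj (jl _)).
by rewrite l1 => -[/eqP]; rewrite eqr_sqrt ?lam0// => /eqP.
Qed.

End schur_multipliers.

(** * Gram matrix of a unimodular 2 x 2 block *)

Section two_by_two.
Context {R : realType} {I : choiceType}.
Local Notation C := R[i].
Variables (i k j l : I) (B : I -> I -> C).
Hypotheses (ik : i != k) (jl : j != l) (B1 : forall m n, `|B m n| = 1).

Definition gram_offdiag : C := (B i j)^* * B i l + (B k j)^* * B k l.

Let t := complex.Re `|gram_offdiag|.
(** The phase of g^*, so that g = t w^*. The value 1 for g = 0 keeps [w] unimodular in the
    degenerate case. *)
Let w : C := if gram_offdiag == 0 then 1 else gram_offdiag^* / `|gram_offdiag|.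
Let h : C := (Num.sqrt 2^-1)%:C.

Definition gram_eigenvalue (m : I) : R := if m == j then 2 + t else 2 - t.

(* The columns (1, w) and (w^*, -1), divided by sqrt 2, diagonalise the Gram
   matrix [[2, t w^*], [t w, 2]] with eigenvalues 2 + t and 2 - t. *)
Definition gram_eigenvector (m n : I) : C :=
  h * (if m == j then if n == j then 1 else w^*
       else if n == j then w else - 1).

Let us1 : uniq [:: i; k]. Proof. by rewrite /= inE ik. Qed.
Let us : uniq [:: j; l]. Proof. by rewrite /= inE jl. Qed.

Let normB m n : B m n * (B m n)^* = 1.
Proof. by rewrite -sqr_normc B1 expr1n. Qed.

Let hh : h * h = 2^-1.
Proof.
rewrite /h -rmorphM/= -expr2 sqr_sqrtr ?invr_ge0//.
by rewrite fmorphV/= rmorph_nat.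
Qed.

Let hJ : h^* = h. Proof. exact: conjc_real. Qed.

Let ww : w * w^* = 1.
Proof.
rewrite -sqr_normc /w; case: eqP => [_|/eqP g0]; first by rewrite normr1 expr1n.
by rewrite normrM normcJ normfV normr_id divff ?normr_eq0// expr1n.
Qed.

Let gE : gram_offdiag = t%:C * w^*.
Proof.
rewrite /t Re_normK /w; case: eqP => [->|/eqP g0]; first by rewrite normr0 mul0r.
rewrite conjcM conjcK conjc_inv -Re_normK conjc_real Re_normK mulrC divfK//.
by rewrite normr_eq0.
Qed.

Lemma norm_gram_offdiag_le2 : t <= 2.
Proof.
rewrite -lecR /t Re_normK (le_trans (ler_normD _ _))// !normrM !normcJ !B1.
by rewrite mulr1 rmorph_nat.
Qed.

Let gram_eigenvalue_ge0 m : 0 <= gram_eigenvalue m.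
Proof.
rewrite /gram_eigenvalue; case: ifP => _; last first.
  by rewrite subr_ge0 norm_gram_offdiag_le2.
by rewrite addr_ge0// Re_norm_ge0.
Qed.

Let lj : (l == j) = false. Proof. by rewrite eq_sym (negbTE jl). Qed.
Let jlF : (j == l) = false. Proof. exact: negbTE. Qed.

Let VJ m n : (gram_eigenvector m n)^* = gram_eigenvector n m.
Proof.
rewrite /gram_eigenvector conjcM hJ; congr (_ * _).
by case: eqP; case: eqP => _ _; rewrite ?conjc1 ?conjcK// (rmorphN1 (@conjc R)).
Qed.

(** Since [VJ] makes the eigenvector matrix Hermitian, squaring to the identity makes it unitary,
    which yields [V_col] and [V_row] at once. *)
Let hermitian_involution : {in [:: j; l] &, forall m n,
  \sum_(q <- [:: j; l]) gram_eigenvector m q * gram_eigenvector q n = (m == n)%:R}.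
Proof.
move=> m n; rewrite !inE !big_cons big_nil addr0 /gram_eigenvector eqxx lj.
move=> /orP[]/eqP-> /orP[]/eqP->; rewrite ?eqxx ?lj ?jlF /=.
- rewrite [LHS](_ : _ = h * h * (1 + w * w^*)); last by ring.
  by rewrite ww hh; field.
- by ring.
- by ring.
- rewrite [LHS](_ : _ = h * h * (1 + w * w^*)); last by ring.
  by rewrite ww hh; field.
Qed.

Let V_col : {in [:: j; l] &, forall m n,
  \sum_(q <- [:: j; l]) gram_eigenvector q m * (gram_eigenvector q n)^* = (m == n)%:R}.
Proof.
move=> m n ms ns; rewrite eq_sym -hermitian_involution//.
by apply: eq_bigr => q _; rewrite VJ mulrC.
Qed.

Let V_row : {in [:: j; l] &, forall m n,
  \sum_(q <- [:: j; l]) gram_eigenvector m q * (gram_eigenvector n q)^* = (m == n)%:R}.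
Proof.
by move=> m n ms ns; rewrite -hermitian_involution//; apply: eq_bigr => q _; rewrite VJ.
Qed.

Let gram_diagonalized : {in [:: j; l] &, forall m n,
  \sum_(q <- [:: i; k]) (B q m)^* * B q n =
  diagonalized [:: j; l] gram_eigenvector gram_eigenvalue m n}.
Proof.
have gJ : (B i l)^* * B i j + (B k l)^* * B k j = t%:C * w.
  rewrite -[RHS]conjcK conjcM conjc_real -gE conjcD !conjcM !conjcK.
  by rewrite mulrC [X in _ + X]mulrC.
have g2 m : (B i m)^* * B i m + (B k m)^* * B k m = 2.
  by rewrite ![_^* * _]mulrC !normB.
have lamj : (gram_eigenvalue j)%:C = 2 + t%:C.
  by rewrite /gram_eigenvalue eqxx rmorphD rmorph_nat.
have laml : (gram_eigenvalue l)%:C = 2 - t%:C.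
  by rewrite /gram_eigenvalue lj rmorphB rmorph_nat.
move=> m n; rewrite /diagonalized !inE !big_cons !big_nil !addr0.
rewrite !VJ lamj laml /gram_eigenvector eqxx lj.
move=> /orP[]/eqP-> /orP[]/eqP->; rewrite ?eqxx ?lj ?jlF /=.
- rewrite g2 [RHS](_ : _ = h * h * (2 * (1 + w * w^*) + t%:C * (1 - w * w^*))); last by ring.
  by rewrite ww hh; field.
- rewrite -/gram_offdiag gE [RHS](_ : _ = h * h * (2 * (t%:C * w^*))); last by ring.
  by rewrite hh; field.
- rewrite gJ [RHS](_ : _ = h * h * (2 * (t%:C * w))); last by ring.
  by rewrite hh; field.
- rewrite g2 [RHS](_ : _ = h * h * (2 * (1 + w * w^*) + t%:C * (w * w^* - 1))); last by ring.
  by rewrite ww hh; field.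
Qed.

Lemma schatten_two_by_two p : (0 < p)%E ->
  schatten p (finop [:: i; k] [:: j; l] B).
Proof.
exact: (finop_schatten us V_col V_row us1 gram_eigenvalue_ge0 gram_diagonalized).
Qed.

Lemma schatten_norm_two_by_two (r : R) : r != 0 ->
  schatten_norm r%:E (finop [:: i; k] [:: j; l] B) =
  (((2 + t) `^ (r / 2) + (2 - t) `^ (r / 2)) `^ r^-1)%:E.
Proof.
move=> r0; rewrite (schatten_norm_finop us V_col V_row us1 gram_eigenvalue_ge0
  gram_diagonalized)//.
by rewrite !big_cons big_nil addr0 /gram_eigenvalue eqxx lj.
Qed.

Lemma operator_norm_two_by_two :
  operator_norm (finop [:: i; k] [:: j; l] B) = (Num.sqrt (2 + t))%:E.
Proof.
rewrite (operator_norm_finop us V_col V_row us1 gram_eigenvalue_ge0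
  gram_diagonalized (mem_head _ _)) /gram_eigenvalue ?eqxx//.
move=> m _; case: ifP => // _; have := Re_norm_ge0 gram_offdiag.
by rewrite -/t; lra.
Qed.

(** Two unimodular numbers [u], [v] with |u + v| = 2 coincide, since the parallelogram law leaves |u
    - v| = 0. Unimodularity of the entries then turns u = v into the vanishing of the minor. *)
Lemma gram_offdiag_eq2 : t = 2 -> B i j * B k l = B i l * B k j.
Proof.
move=> t2; set u := (B i j)^* * B i l; set v := (B k j)^* * B k l.
have uv : gram_offdiag = u + v by [].
have uu : u * u^* = 1 by rewrite /u conjcM conjcK mulrACA mulrC normB [_^* * _]mulrC normB mulr1.
have vv : v * v^* = 1 by rewrite /v conjcM conjcK mulrACA mulrC normB [_^* * _]mulrC normB mulr1.
have : (u - v) * (u - v)^* = 0.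
  have : (u + v) * (u + v)^* = 4.
    rewrite -uv mulcJ_norm -/t t2 rmorphXn rmorph_nat.
    by ring.
  rewrite conjcB conjcD => uv4.
  rewrite [LHS](_ : _ = 2 * (u * u^*) + 2 * (v * v^*) - (u + v) * (u^* + v^*)); last by ring.
  by rewrite uv4 uu vv; ring.
move=> /eqP; rewrite mulf_eq0 conjc_eq0 orbb subr_eq0 => /eqP uE.
rewrite -[B k l]mul1r -(normB k j) -mulrA -/v -uE /u.
rewrite [LHS](_ : _ = (B i j * (B i j)^*) * (B i l * B k j)); last by ring.
by rewrite normB mul1r.
Qed.

End two_by_two.

(** * A strict inequality for sums of two powers *)

Section powers.
Context {R : realType}.

(** Division by 4 gives [x] and [y] with sum 1 and x^q + y^q = x + y. If t < 2, both lie strictly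
    between 0 and 1, where z^q > z for q < 1 and z^q < z for q > 1, so adding the two strict
    inequalities contradicts the equality. *)
Lemma powR_add_extremal (q t : R) : 0 < q -> q != 1 -> 0 <= t <= 2 ->
  (2 + t) `^ q + (2 - t) `^ q = 4 `^ q -> t = 2.
Proof.
move=> q0 q1 /andP[t0 t2] E; apply/eqP; rewrite eq_le t2/= leNgt.
apply/negP => tlt2; pose x := (2 + t) / 4; pose y := (2 - t) / 4.
have x0 : 0 < x by rewrite /x; lra.
have x1 : x < 1 by rewrite /x; lra.
have y0 : 0 < y by rewrite /y; lra.
have y1 : y < 1 by rewrite /y; lra.
have xy : x `^ q + y `^ q = x + y.
  have q4 : 4 `^ q != 0 :> R by rewrite gt_eqF// powR_gt0.
  apply: (mulfI q4); rewrite mulrDr -!powRM ?ltW//.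
  rewrite [4 * x](_ : _ = 2 + t); last by rewrite /x; field.
  rewrite [4 * y](_ : _ = 2 - t); last by rewrite /y; field.
  by rewrite E /x /y; field.
have powlt (z e : R) : 0 < z -> z < 1 -> 0 < e -> z `^ e < 1.
  move=> z0 z1 e0; rewrite [ltRHS](_ : _ = 1 `^ e); last by rewrite powR1.
  by apply: gt0_ltr_powR; rewrite ?nnegrE ?ltW.
have [q1lt|q1gt|q1eq] := ltgtP q 1; last by rewrite q1eq eqxx in q1.
  have lt z : 0 < z -> z < 1 -> z < z `^ q.
    move=> z0 z1; rewrite -[ltLHS]powRr1 ?ltW// -[in ltLHS](subrK q 1) powRD.
      by rewrite gtr_pMl ?powR_gt0// powlt// subr_gt0.
    by rewrite subrK oner_eq0.
  by have := ltrD (lt x x0 x1) (lt y y0 y1); rewrite xy ltxx.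
have lt z : 0 < z -> z < 1 -> z `^ q < z.
  move=> z0 z1; rewrite -mulr_powRB1 ?ltW//.
  by rewrite gtr_pMr// powlt// subr_gt0.
by have := ltrD (lt x x0 x1) (lt y y0 y1); rewrite xy ltxx.
Qed.

End powers.

(** * Vanishing of the 2 x 2 minors and factorisation *)

Lemma isometric_minor {R : realType} {I : choiceType} (p : \bar R)
    (A : I -> I -> R[i]) (i k j l : I) :
  (1%:E <= p)%E -> p <> 2%:E -> isometric_schur_multiplier p A ->
  A i j * A k l = A i l * A k j.
Proof.
move=> p1 p2 A_isom; have A1 := isometric_unimodular p1 A_isom.
have [->|ik] := eqVneq i k; first by rewrite mulrC.
have [->//|jl] := eqVneq j l.
have p0 : (0 < p)%E by exact: lt_le_trans p1.
pose one (m n : I) : R[i] := 1.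
have one1 m n : `|one m n| = 1 by rewrite normr1.
have oneE : schur A one = A.
  by apply/funext => m; apply/funext => n; rewrite /schur mulr1.
have t_one : complex.Re `|gram_offdiag i k j l one| = 2.
  apply: complexI; rewrite Re_normK /gram_offdiag /one conjc1 mulr1.
  by rewrite -mulr2n normr_nat rmorph_nat.
have us1 : uniq [:: i; k] by rewrite /= inE ik.
have us2 : uniq [:: j; l] by rewrite /= inE jl.
have := isometric_finop A_isom us1 us2 (schatten_two_by_two ik jl one1 p0).
rewrite oneE => /(_ (schatten_two_by_two ik jl A1 p0)) normE.
apply: (gram_offdiag_eq2 A1); move: normE.
set t := complex.Re `|gram_offdiag i k j l A|.
have t0 : 0 <= t by exact: Re_norm_ge0.
have t2 : t <= 2 by exact: norm_gram_offdiag_le2.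
case: p p1 p2 p0 {A_isom} => [r| |//]; last first.
  (* For p = oo the top eigenvalues 2 + t and 4 are compared directly. *)
  rewrite /= !operator_norm_two_by_two// t_one => _ _ _ -[/eqP].
  by rewrite eqr_sqrt ?addr_ge0// => /eqP/addrI.
rewrite lte_fin => _ r2 r0; have rN0 : r != 0 by rewrite gt_eqF.
(* The all-ones block has eigenvalues 4 and 0, and 0^(r/2) = 0, so only 4^(r/2) remains on its
   side. *)
rewrite !schatten_norm_two_by_two// t_one -/t subrr powR0 ?mulf_neq0 ?invr_neq0//.
rewrite addr0 -natrD => -[].
move/powR_injective; rewrite invr_gt0 !nnegrE addr_ge0 ?powR_ge0//.
move=> /(_ r0 isT isT); apply: powR_add_extremal; rewrite ?divr_gt0 ?t0//.
(* The excluded exponent r/2 = 1 is exactly p = 2. *)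
apply: contra_notN r2 => /eqP r21; congr (_%:E).
by rewrite -[LHS](@divfK _ 2)// r21 mul1r.
Qed.

Theorem theorem5p1 (R : realType) (I : choiceType) (p : \bar R)
    (A : I -> I -> R[i]) :
  (1%:E <= p)%E -> p <> 2%:E ->
  isometric_schur_multiplier p A ->
  exists a b : I -> R[i],
    [/\ forall i, `|a i| = 1, forall j, `|b j| = 1 &
        forall i j, A i j = a i * b j].
Proof.
move=> p1 p2 A_isom; have A1 := isometric_unimodular p1 A_isom.
(* The factorisation is based at an index [i0]; for empty [I] every condition is vacuous. *)
have [[i0 _]|I0] := pselect (exists o : I, True); last first.
  by exists (fun _ => 1), (fun _ => 1); split=> i; case: I0; exists i.
(* The minor on rows i, i0 and columns j, i0 gives A i j * A i0 i0 = A i i0 * A i0 j, to be divided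
   by the nonzero [A i0 i0]. *)
exists (A^~ i0), (fun j => A i0 j / A i0 i0); split=> [//|j|i j].
  by rewrite normrM normfV !A1 invr1 mulr1.
have A00 : A i0 i0 != 0 by rewrite -normr_eq0 A1 oner_eq0.
by apply: (mulIf A00); rewrite mulrA divfK// (isometric_minor _ _ _ _ p1 p2 A_isom).
Qed.
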